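(* There is a universal constant $\gamma\ge1$ such that for all positive integers $m\le N$, all $1\le p\le\frac{2m}{m+1}$, and $r$ with $\frac1r=\frac1p-\frac12$, \[ \frac1{\gamma^m}\Big(\frac Nm\Big)^{\frac mr-\frac12}\le\chi_p\big(\mathcal{B}_N^{=m}\big)\le\chi_p\big(\mathcal{B}_N^{\le m}\big)\le\gamma^m\Big(\frac Nm\Big)^{\frac mr-\frac12}. \]
   Context: $\mathcal{B}_N^{\le m}$ (resp. $\mathcal{B}_N^{=m}$) is the space of functions $f\colon\{-1,1\}^N\to\mathbb{R}$, with sup norm, whose Fourier–Walsh coefficients $\widehat f(S)=2^{-N}\sum_xf(x)\prod_{n\in S}x_n$ ($S\subset\{1,\dots,N\}$) vanish for $|S|>m$ (resp. $|S|\ne m$). The $p$-Sidon constant $\chi_p(V)$ is the best $c$ with $(\sum_S|\widehat f(S)|^p)^{1/p}\le c\|f\|_\infty$ for all $f\in V$. *)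

(* Defs.v *)
From HB Require Import structures.
From mathcomp Require Import all_boot all_order all_algebra.
From mathcomp Require Import all_classical all_reals all_analysis.
Set Implicit Arguments. Unset Strict Implicit. Unset Printing Implicit Defensive.
Import Order.TTheory GRing.Theory Num.Theory.
Local Open Scope classical_set_scope.
Local Open Scope ring_scope.

(* The cube {-1,1}^N: a point is encoded by b : {ffun 'I_N -> bool},
   with coordinate x_n = sgnb (b n)  (true |-> -1, false |-> 1). *)
Definition cube (N : nat) := {ffun 'I_N -> bool}.

Definition sgnb (R : ringType) (b : bool) : R := if b then -1 else 1.

Definition walsh (R : ringType) (N : nat) (S : {set 'I_N}) (x : cube N) : R :=
  \prod_(n in S) sgnb R (x n).

Definition fcoef (R : realType) (N : nat) (f : cube N -> R) (S : {set 'I_N}) : R :=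
  (2 ^+ N)^-1 * \sum_(x : cube N) f x * walsh R S x.

Definition supnorm (R : realType) (N : nat) (f : cube N -> R) : R :=
  \big[Num.max/0]_(x : cube N) `|f x|.

Definition Ble (R : realType) (N m : nat) (f : cube N -> R) : Prop :=
  forall S : {set 'I_N}, (m < #|S|)%N -> fcoef f S = 0.
Definition Beq (R : realType) (N m : nat) (f : cube N -> R) : Prop :=
  forall S : {set 'I_N}, #|S| != m -> fcoef f S = 0.

Definition coef_pnorm (R : realType) (N : nat) (p : R) (f : cube N -> R) : R :=
  powR (\sum_(S : {set 'I_N}) powR `|fcoef f S| p) p^-1.

(* p-Sidon constant of V: the best c with ||fhat||_p <= c ||f||_oo for f in V,
   i.e. the supremum of ||fhat||_p / ||f||_oo over nonzero f in V. *)
Definition sidon (R : realType) (N : nat) (p : R) (V : (cube N -> R) -> Prop) : R :=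
  sup [set c | exists f, V f /\ supnorm f != 0 /\ c = coef_pnorm p f / supnorm f].

(* Main.v *)
Require Import Defs.
From HB Require Import structures.
From mathcomp Require Import all_boot all_order all_algebra.
From mathcomp Require Import all_classical all_reals all_analysis.
From mathcomp Require Import Rstruct Rstruct_topology.
From mathcomp Require Import fintype finset ring lra.
Set Implicit Arguments. Unset Strict Implicit. Unset Printing Implicit Defensive.
Import Order.TTheory GRing.Theory Num.Theory.
Local Open Scope ring_scope.

(* Upper bound.  Let c_S be the coefficients of f, deg f <= m, and
   b_i = (sum_(S containing i) c_S^2)^(1/2).  By hypercontractivity b_i is at
   most C^m times the L^1 norm of the partial derivative D_i f at x/2, and the
   sum over i of |D_i f (x/2)| is the linear coefficient of a univariate
   polynomial of degree at most m bounded by ||f||; so sum_i b_i <= C^m ||f||.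
   After normalizing sum_i b_i = 1, put w_S = sum_(i in S) 1/b_i.  Young's
   inequality gives c_S^(2m/(m+1)) <= c_S^2 w_S + w_S^(-m); here
   sum_S c_S^2 w_S = sum_i b_i = 1, while w_S^(-m) <= prod_(i in S) b_i, whose sum
   over S is prod_i (1 + b_i) <= exp 1.  This is a Bohnenblust-Hille inequality
   with constant C^m and p = 2m/(m+1); smaller p follow by interpolation since
   at most (e N/m)^m coefficients are nonzero.
   Lower bound.  Some choice of signs makes the sup norm of sum_(|S| = m) +-x_S at
   most 4 sqrt(N n), where n = C(N,m) >= (N/m)^m, and its coefficients have
   l^p norm n^(1/p). *)


(** * Walsh expansions on the cube: orthogonality, Parseval, multilinear extension *)

Section Walsh.
Context {R : realType} {N : nat}.
Implicit Types (S T A : {set 'I_N}) (x y : cube N) (c : {set 'I_N} -> R).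

Definition avg (h : cube N -> R) : R := (2 ^+ N)^-1 * \sum_x h x.

Definition walsh_sum c x : R := \sum_S c S * walsh R S x.

Lemma avgD g h : avg (fun x => g x + h x) = avg g + avg h.
Proof. by rewrite /avg big_split mulrDr. Qed.

Lemma avgZ a g : avg (fun x => a * g x) = a * avg g.
Proof. by rewrite /avg -mulr_sumr mulrCA. Qed.

Lemma avg_sum (I : finType) (h : I -> cube N -> R) :
  avg (fun x => \sum_i h i x) = \sum_i avg (h i).
Proof. by rewrite /avg exchange_big -mulr_sumr. Qed.

Lemma eq_avg g h : g =1 h -> avg g = avg h.
Proof. by move=> gh; rewrite /avg (eq_bigr h). Qed.

Lemma ler_avg g h : (forall x, g x <= h x) -> avg g <= avg h.
Proof.
move=> gh; rewrite ler_wpM2l ?invr_ge0 ?exprn_ge0 //.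
by apply: ler_sum.
Qed.

Lemma avg_ge0 g : (forall x, 0 <= g x) -> 0 <= avg g.
Proof.
by move=> g0; rewrite mulr_ge0 ?invr_ge0 ?exprn_ge0 ?sumr_ge0.
Qed.

Lemma sum_cube_prod (F : 'I_N -> bool -> R) :
  \sum_(x : cube N) \prod_i F i (x i) = \prod_i (F i true + F i false).
Proof.
rewrite -(bigA_distr_bigA F).
by apply: eq_bigr => i _; rewrite big_bool.
Qed.

Lemma avg_cst a : avg (fun=> a) = a.
Proof.
rewrite /avg sumr_const card_ffun card_bool card_ord -[a *+ _]mulr_natl natrX.
by rewrite mulKf // expf_neq0.
Qed.

Lemma sgnb_sqr b : sgnb R b * sgnb R b = 1.
Proof. by case: b; rewrite /sgnb ?mulrNN mulr1. Qed.

Lemma normr_sgnb b : `|sgnb R b| = 1.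
Proof. by case: b; rewrite /sgnb ?normrN1 ?normr1. Qed.

Lemma walsh0 x : walsh R set0 x = 1.
Proof. by rewrite /walsh big_set0. Qed.

Lemma walshE S x : walsh R S x = \prod_i (if i \in S then sgnb R (x i) else 1).
Proof. by rewrite /walsh big_mkcond. Qed.

Lemma walshU1 i S x : i \notin S ->
  walsh R (i |: S) x = sgnb R (x i) * walsh R S x.
Proof. by move=> iS; rewrite /walsh big_setU1. Qed.

Lemma normr_walsh S x : `|walsh R S x| = 1.
Proof. by rewrite /walsh normr_prod big1 // => i _; rewrite normr_sgnb. Qed.

Lemma walsh_sqr S x : walsh R S x * walsh R S x = 1.
Proof. by rewrite /walsh -big_split big1 //= => i _; rewrite sgnb_sqr. Qed.

(** If [S] and [T] differ, a coordinate in exactly one of them contributes the factor -1 + 1 = 0. *)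
Lemma avg_walshM S T :
  avg (fun x => walsh R S x * walsh R T x) = (S == T)%:R.
Proof.
case: eqP => [->|/eqP neST].
  by rewrite (eq_avg (walsh_sqr T)) avg_cst.
rewrite /avg; under eq_bigr do rewrite !walshE -big_split /=.
rewrite (sum_cube_prod (fun i b => (if i \in S then sgnb R b else 1) *
   (if i \in T then sgnb R b else 1))).
suff [i iST] : exists i, (i \in S) != (i \in T).
  rewrite (bigD1 i) //=; case: (i \in S) (i \in T) iST => [] [] //= _.
    by rewrite !mulr1 addNr mul0r mulr0.
  by rewrite !mul1r addNr mul0r mulr0.
apply/existsP; apply: contraNT neST; rewrite negb_exists => /forallP h.
by apply/eqP/setP => i; move: (h i); rewrite negbK => /eqP.
Qed.

Lemma fcoefE (f : cube N -> R) S : fcoef f S = avg (fun x => f x * walsh R S x).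
Proof. by []. Qed.

Lemma fcoef_walsh_sum c S : fcoef (walsh_sum c) S = c S.
Proof.
rewrite fcoefE (eq_avg (h := fun x => \sum_T c T * (walsh R T x * walsh R S x))).
  rewrite avg_sum; under eq_bigr do rewrite avgZ avg_walshM.
  rewrite (bigD1 S) //= eqxx mulr1 big1 ?addr0 // => T /negPf ->.
  by rewrite mulr0.
by move=> x; rewrite mulr_suml; apply: eq_bigr => T _; rewrite mulrA.
Qed.

Lemma parseval c : avg (fun x => walsh_sum c x ^+ 2) = \sum_S c S ^+ 2.
Proof.
rewrite (eq_avg (h := fun x => \sum_S c S * (walsh_sum c x * walsh R S x))).
  rewrite avg_sum; apply: eq_bigr => S _.
  by rewrite avgZ -fcoefE fcoef_walsh_sum.
move=> x; rewrite expr2 {1}/walsh_sum mulr_suml.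
by apply: eq_bigr => S _; rewrite mulrAC mulrA.
Qed.

(** Expanding the Riesz product of the 1 + x_i z_i over sets gives the sum of the [walsh R S x]
    times z^S. *)
Lemma multilinear_extE (f : cube N -> R) (z : 'I_N -> R) :
  \sum_S fcoef f S * \prod_(i in S) z i =
  avg (fun x => f x * \prod_i (1 + sgnb R (x i) * z i)).
Proof.
rewrite (eq_avg
  (h := fun x => \sum_(S : {set _}) (\prod_(i in S) z i) * (f x * walsh R S x))).
  rewrite avg_sum; apply: eq_bigr => S _.
  by rewrite avgZ -fcoefE mulrC.
move=> x; under eq_bigr do rewrite addrC.
rewrite bigA_distr mulr_sumr; apply: eq_bigr => S _.
rewrite mulrCA; congr (_ * _).
by rewrite /walsh -big_split [RHS]big_mkcond /=; under [RHS]eq_bigr do rewrite mulrC.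
Qed.

Lemma ler_supnorm (f : cube N -> R) x : `|f x| <= supnorm f.
Proof. exact: (le_bigmax 0 (fun x => `|f x|)). Qed.

Lemma supnorm_ge0 (f : cube N -> R) : 0 <= supnorm f.
Proof. exact: le_trans (ler_supnorm f [ffun=> true]). Qed.

(** For z in [-1,1]^N the Riesz product is nonnegative with average 1, so the extension at z is a
    weighted mean of values of [f]. *)
Lemma ler_norm_multilinear (f : cube N -> R) (z : 'I_N -> R) :
  (forall i, `|z i| <= 1) ->
  `|\sum_S fcoef f S * \prod_(i in S) z i| <= supnorm f.
Proof.
move=> z1; rewrite multilinear_extE.
have w0 x : 0 <= \prod_i (1 + sgnb R (x i) * z i).
  apply: prodr_ge0 => i _; rewrite -lerBlDl sub0r.
  have : `|sgnb R (x i) * z i| <= 1 by rewrite normrM normr_sgnb mul1r.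
  by rewrite ler_norml => /andP[].
have -> : supnorm f = avg (fun x => supnorm f * \prod_i (1 + sgnb R (x i) * z i)).
  rewrite avgZ /avg.
  rewrite (sum_cube_prod (fun i b => 1 + sgnb R b * z i)).
  under eq_bigr => i _ do rewrite mulN1r mul1r addrACA addNr addr0.
  by rewrite prodr_const card_ord mulVf ?mulr1 // expf_neq0.
rewrite /avg normrM ger0_norm ?invr_ge0 ?exprn_ge0 //.
rewrite ler_wpM2l ?invr_ge0 ?exprn_ge0 //.
apply: le_trans (ler_norm_sum _ _ _) _; apply: ler_sum => x _.
by rewrite normrM (ger0_norm (w0 x)) ler_wpM2r ?ler_supnorm.
Qed.

Lemma ler_norm_fcoef (f : cube N -> R) S : `|fcoef f S| <= supnorm f.
Proof.
rewrite -[leRHS](avg_cst (supnorm f)) fcoefE /avg normrM.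
rewrite ger0_norm ?invr_ge0 ?exprn_ge0 // ler_wpM2l ?invr_ge0 ?exprn_ge0 //.
apply: le_trans (ler_norm_sum _ _ _) _; apply: ler_sum => x _.
by rewrite normrM normr_walsh mulr1 ler_supnorm.
Qed.

End Walsh.

(** * Hypercontractivity: L^2 against L^1 for functions of low degree *)

Lemma discriminant_le (R : realFieldType) (a b d : R) : 0 <= b ->
  (forall t, 0 <= a - 2 * t * d + t ^+ 2 * b) -> d ^+ 2 <= a * b.
Proof.
rewrite le_eqVlt => /predU1P[<-|b0] h.
  rewrite mulr0; have [->|dn0] := eqVneq d 0; first by rewrite expr0n.
  (* With b = 0 and d nonzero, this t gives the affine function the value -1. *)
  have := h ((a + 1) / (2 * d)); rewrite mulr0 addr0.
  have -> : 2 * ((a + 1) / (2 * d)) * d = a + 1 by field.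
  by lra.
have := h (d / b).
have -> : a - 2 * (d / b) * d + (d / b) ^+ 2 * b = a - d ^+ 2 / b.
  by field; rewrite gt_eqF.
by rewrite subr_ge0 ler_pdivrMr.
Qed.

Section Hypercontractivity.
Context {R : realType} {N : nat}.
Implicit Types (S T A : {set 'I_N}) (x y : cube N) (c : {set 'I_N} -> R).
Implicit Types g h : cube N -> R.

Lemma avg_cauchy_schwarz g h :
  avg (fun x => g x * h x) ^+ 2 <=
  avg (fun x => g x ^+ 2) * avg (fun x => h x ^+ 2).
Proof.
apply: discriminant_le => [|t]; first by apply: avg_ge0 => x; rewrite sqr_ge0.
rewrite -mulNr -!avgZ -!avgD; apply: avg_ge0 => x.
by rewrite (_ : _ + _ = (g x - t * h x) ^+ 2) ?sqr_ge0 //; ring.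
Qed.

Definition flip (i : 'I_N) x : cube N := [ffun j => (j == i) (+) x j].

Lemma flipK i : involutive (flip i).
Proof. by move=> x; apply/ffunP => j; rewrite !ffunE addbA addbb. Qed.

Lemma avg_flip i g : avg (fun x => g (flip i x)) = avg g.
Proof.
rewrite /avg [in RHS](reindex_inj (h := flip i)) //.
exact: inv_inj (flipK i).
Qed.

Lemma walsh_flip i S x : i \notin S -> walsh R S (flip i x) = walsh R S x.
Proof.
move=> iS; apply: eq_bigr => j jS; rewrite ffunE.
by rewrite (negPf (memPn iS j jS)).
Qed.

(** Flipping coordinate [i] preserves the average and negates the integrand. *)
Lemma avg_sgnbM i h : (forall x, h (flip i x) = h x) ->
  avg (fun x => sgnb R (x i) * h x) = 0.
Proof.
move=> hi; set a := avg _; suff : a = - a by lra.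
rewrite {1}/a -(avg_flip i) -mulN1r -avgZ; apply: eq_avg => x.
by rewrite hi ffunE eqxx; case: (x i); rewrite /sgnb /=; ring.
Qed.

Lemma sum_subsetU1 i A (F : {set 'I_N} -> R) : i \notin A ->
  \sum_(S : {set 'I_N} | S \subset i |: A) F S =
  \sum_(S : {set 'I_N} | S \subset A) F S +
  \sum_(S : {set 'I_N} | S \subset A) F (i |: S).
Proof.
move=> iA; rewrite (bigID (fun S => i \in S)) /= addrC; congr (_ + _).
  by apply: eq_bigl => S; rewrite -subsetD1 setU1K.
rewrite (reindex_onto (fun S => i |: S) (fun S => S :\ i)) /=.
  apply: eq_bigl => S; rewrite setU11 andbT.
  apply/andP/idP => [[SA /eqP <-]|SA]; first by rewrite -[A](setU1K iA) setSD.
  split; first by rewrite setUS.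
  by rewrite setU1K //; apply: contra iA; exact: (subsetP SA).
by move=> S /andP[_ iS]; rewrite setD1K.
Qed.

(* Induction on [A]: splitting off a coordinate [i] as [g0 + x_i g1], the fourth
   moment is [E g0^4 + 6 E g0^2 g1^2 + E g1^4 <= (A0 + 3 A1)^2]. *)
Lemma bonami_subset A c :
  avg (fun x => (\sum_(S : {set 'I_N} | S \subset A) c S * walsh R S x) ^+ 4) <=
  (\sum_(S : {set 'I_N} | S \subset A) 3 ^+ #|S| * c S ^+ 2) ^+ 2.
Proof.
move: {2}#|A| (erefl #|A|) => n; elim: n => [|n IHn] in A c *.
  move=> /eqP; rewrite cards_eq0 => /eqP ->.
  under eq_bigl do rewrite subset0.
  rewrite (eq_avg (h := fun=> c set0 ^+ 4)) => [|x].
    by rewrite avg_cst big_pred1_eq cards0 expr0 mul1r -exprM.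
  under eq_bigl do rewrite subset0.
  by rewrite big_pred1_eq walsh0 mulr1.
move=> cardA; have [i iA] : exists i, i \in A.
  by apply/set0Pn; rewrite -cards_eq0 cardA.
pose B := A :\ i; have iB : i \notin B by rewrite setD11.
have cardB : #|B| = n by move: cardA; rewrite (cardsD1 i A) iA => -[].
have notin S : S \subset B -> i \notin S.
  by move=> SB; apply: contra iB; exact: (subsetP SB).
pose g0 x := \sum_(S : {set 'I_N} | S \subset B) c S * walsh R S x.
pose g1 x := \sum_(S : {set 'I_N} | S \subset B) c (i |: S) * walsh R S x.
have fl0 x : g0 (flip i x) = g0 x.
  by apply: eq_bigr => S /notin iS; rewrite walsh_flip.
have fl1 x : g1 (flip i x) = g1 x.
  by apply: eq_bigr => S /notin iS; rewrite walsh_flip.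
rewrite -(setD1K iA) -/B sum_subsetU1 //.
set A0 := \sum_(S : {set 'I_N} | S \subset B) 3 ^+ #|S| * c S ^+ 2.
pose A1 := \sum_(S : {set 'I_N} | S \subset B) 3 ^+ #|S| * c (i |: S) ^+ 2.
have -> : \sum_(S : {set 'I_N} | S \subset B)
    3 ^+ #|i |: S| * c (i |: S) ^+ 2 = 3 * A1.
  rewrite mulr_sumr; apply: eq_bigr => S /notin iS.
  by rewrite cardsU1 iS add1n exprS mulrA.
have le0 : avg (fun x => g0 x ^+ 4) <= A0 ^+ 2 by exact: IHn.
have le1 : avg (fun x => g1 x ^+ 4) <= A1 ^+ 2.
  exact: (IHn B (fun S => c (i |: S))).
have A0ge0 : 0 <= A0 by apply: sumr_ge0 => S _; rewrite mulr_ge0 ?sqr_ge0 ?exprn_ge0.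
have A1ge0 : 0 <= A1 by apply: sumr_ge0 => S _; rewrite mulr_ge0 ?sqr_ge0 ?exprn_ge0.
pose P := avg (fun x => g0 x ^+ 2 * g1 x ^+ 2).
have leP : P <= A0 * A1.
  have P_ge0 : 0 <= P by apply: avg_ge0 => x; rewrite mulr_ge0 ?sqr_ge0.
  rewrite -(@ler_pXn2r _ 2) ?nnegrE ?(mulr_ge0 A0ge0) //.
  apply: le_trans (avg_cauchy_schwarz _ _) _.
  rewrite (eq_avg (h := fun x => g0 x ^+ 4)) => [|x]; last by rewrite -exprM.
  rewrite (eq_avg (g := fun x => (g1 x ^+ 2) ^+ 2) (h := fun x => g1 x ^+ 4)).
    rewrite exprMn ler_pM //; apply: avg_ge0 => x; exact: exprn_even_ge0.
  by move=> x; rewrite -exprM.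
have -> : avg (fun x => (\sum_(S : {set 'I_N} | S \subset i |: B)
      c S * walsh R S x) ^+ 4) =
    avg (fun x => g0 x ^+ 4) + 6 * P + avg (fun x => g1 x ^+ 4).
  (* In (g0 + x_i g1)^4 the terms odd in x_i add up to x_i times [odd], whose average vanishes. *)
  pose odd x := 4 * g0 x ^+ 3 * g1 x + 4 * g0 x * g1 x ^+ 3.
  have odd0 : avg (fun x => sgnb R (x i) * odd x) = 0.
    by apply: avg_sgnbM => x; rewrite /odd fl0 fl1.
  rewrite -[RHS]addr0 -[X in _ = _ + X]odd0 -avgZ -!avgD; apply: eq_avg => x.
  rewrite sum_subsetU1 // -/(g0 x) (_ : \sum_(S | _) _ = sgnb R (x i) * g1 x).
    by rewrite /odd; case: (x i); rewrite /sgnb; ring.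
  rewrite mulr_sumr; apply: eq_bigr => S /notin iS.
  by rewrite walshU1 // mulrCA.
nra.
Qed.

(** With M_k = E|g|^k and V = M_2, Cauchy-Schwarz gives V^2 <= M_1 M_3 and M_3^2 <= V M_4, while
    Bonami gives M_4 <= 9^m V^2. Hence V^4 <= 9^m M_1^2 V^3, and V^3 cancels. *)
Lemma walsh_L2_le_L1 m c : (forall S, (m < #|S|)%N -> c S = 0) ->
  \sum_S c S ^+ 2 <= 9 ^+ m * avg (fun x => `|walsh_sum c x|) ^+ 2.
Proof.
move=> cm; set g := walsh_sum c; set V := \sum_S _.
have VE : V = avg (fun x => g x ^+ 2) by rewrite parseval.
have V0 : 0 <= V by apply: sumr_ge0 => S _; exact: sqr_ge0.
set M1 := avg _; pose M3 := avg (fun x => `|g x| ^+ 3).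
pose M4 := avg (fun x => g x ^+ 4).
have M1_ge0 : 0 <= M1 by apply: avg_ge0.
have M3_ge0 : 0 <= M3 by apply: avg_ge0 => x; rewrite exprn_ge0.
have le4 : M4 <= 9 ^+ m * V ^+ 2.
  have := bonami_subset setT c.
  rewrite (eq_avg (h := fun x => g x ^+ 4)) => [|x]; last first.
    by congr (_ ^+ 4); apply: eq_bigl => S; rewrite subsetT.
  move=> /le_trans; apply.
  rewrite (_ : 9 ^+ m = (3 ^+ m) ^+ 2); last by rewrite exprAC -[3 ^+ 2]natrX.
  rewrite -exprMn ler_pXn2r ?nnegrE ?mulr_ge0 ?exprn_ge0 //; last first.
    by apply: sumr_ge0 => S _; rewrite mulr_ge0 ?sqr_ge0 ?exprn_ge0.
  rewrite mulr_sumr; under eq_bigl do rewrite subsetT.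
  apply: ler_sum => S _; have [Sm|/cm ->] := leqP #|S| m.
    by rewrite ler_wpM2r ?sqr_ge0 // ler_weXn2l // ler1n.
  by rewrite expr0n !mulr0.
have le13 : V ^+ 2 <= M1 * M3.
  (* The quadratic in t is E |g| (1 - t|g|)^2. *)
  apply: discriminant_le => // t.
  rewrite VE -mulNr -!avgZ -!avgD; apply: avg_ge0 => x.
  have -> : g x ^+ 2 = `|g x| ^+ 2 by rewrite real_normK ?num_real.
  rewrite (_ : _ + _ = `|g x| * (1 - t * `|g x|) ^+ 2); last by rewrite /g; ring.
  by rewrite mulr_ge0 ?sqr_ge0.
have le24 : M3 ^+ 2 <= V * M4.
  have := avg_cauchy_schwarz (fun x => `|g x|) (fun x => g x ^+ 2).
  rewrite (eq_avg (h := fun x => `|g x| ^+ 3)) => [|x]; last first.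
    by rewrite -[g x ^+ 2]real_normK ?num_real // -exprS.
  rewrite (eq_avg (g := fun x => `|g x| ^+ 2) (h := fun x => g x ^+ 2)); last first.
    by move=> x; rewrite real_normK ?num_real.
  rewrite -VE (eq_avg (g := fun x => (g x ^+ 2) ^+ 2) (h := fun x => g x ^+ 4)) //.
  by move=> x; rewrite -exprM.
have [->|Vn0] := eqVneq V 0; first by rewrite mulr_ge0 ?exprn_ge0.
have Vpos : 0 < V by rewrite lt_def Vn0.
rewrite -(ler_pM2l (exprn_gt0 3 Vpos)).
have : (V ^+ 2) ^+ 2 <= (M1 * M3) ^+ 2.
  by rewrite ler_pXn2r ?nnegrE ?sqr_ge0 ?(mulr_ge0 M1_ge0 M3_ge0).
rewrite (_ : (V ^+ 2) ^+ 2 = V ^+ 3 * V); last by ring.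
move=> /le_trans; apply.
rewrite exprMn (_ : V ^+ 3 * _ = M1 ^+ 2 * (V * (9 ^+ m * V ^+ 2))); last by ring.
by rewrite ler_wpM2l ?sqr_ge0 // (le_trans le24) // ler_wpM2l.
Qed.

End Hypercontractivity.

(* If [q] has degree [d > 1], then [2^d q(t/2) - q(t)] has degree less than [d],
   and its linear coefficient is [2^(d-1) - 1] times the one of [q]. *)
Lemma poly_linear_coef_bound (R : realFieldType) m (a : nat -> R) (M : R) :
  (forall t, `|t| <= 1 -> `|\sum_(k < m.+2) a k * t ^+ k| <= M) ->
  `|a 1| <= 5 ^+ m * M.
Proof.
elim: m a M => [|m IHm] a M aM.
  (* For degree at most 1, the linear coefficient is (q(1) - q(-1)) / 2. *)
  have := aM 1; have := aM (-1); rewrite !big_ord_recl !big_ord0 /=.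
  rewrite normrN !normr1 !expr0 !expr1 !mulr1 !addr0 mul1r
    => /(_ (lexx _)) + /(_ (lexx _)).
  by rewrite mulrN1 !ler_norml => /andP[? ?] /andP[? ?]; apply/andP; split; lra.
pose b k := (2 ^+ m.+2 / 2 ^+ k - 1) * a k.
have pow2 : 1 <= 2 ^+ m :> R by rewrite exprn_ege1 // ler1n.
have M0 : 0 <= M by apply: le_trans (aM 0 _); rewrite ?normr0.
have /IHm : forall t, `|t| <= 1 ->
    `|\sum_(k < m.+2) b k * t ^+ k| <= (2 ^+ m.+2 + 1) * M.
  move=> t t1.
  have -> : \sum_(k < m.+2) b k * t ^+ k =
      2 ^+ m.+2 * (\sum_(k < m.+3) a k * (t / 2) ^+ k)
      - \sum_(k < m.+3) a k * t ^+ k.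
    rewrite mulr_sumr -sumrB [RHS]big_ord_recr /= expr_div_n.
    rewrite [X in _ + X](_ : _ = 0) ?addr0.
      by apply: eq_bigr => k _; rewrite /b expr_div_n; field; rewrite expf_neq0.
    by field; rewrite expf_neq0.
  apply: le_trans (ler_normB _ _) _; rewrite mulrDl mul1r lerD ?aM //.
  rewrite normrM ger0_norm ?exprn_ge0 // ler_wpM2l ?exprn_ge0 // aM //.
  by rewrite normrM (ger0_norm (_ : 0 <= 2^-1)) //; lra.
have b1 : b 1%N = (2 * 2 ^+ m - 1) * a 1%N by rewrite /b !exprS; field.
rewrite b1 normrM ger0_norm; last lra.
have pow5 : 0 <= 5 ^+ m :> R by rewrite exprn_ge0.
rewrite !exprS => h.
(* The factor 5 comes from 4u + 1 <= 5 (2u - 1) for u = 2^m >= 1, with equality at u = 1. *)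
have : (2 * 2 ^+ m - 1) * `|a 1%N| <= (2 * 2 ^+ m - 1) * (5 * 5 ^+ m * M).
  apply: le_trans h _.
  have -> : 5 ^+ m * ((2 * (2 * 2 ^+ m) + 1) * M) =
     (5 ^+ m * M) * (2 * (2 * 2 ^+ m) + 1) by ring.
  have -> : (2 * 2 ^+ m - 1) * (5 * 5 ^+ m * M) =
     (5 ^+ m * M) * (5 * (2 * 2 ^+ m - 1)) by ring.
  by rewrite ler_wpM2l ?mulr_ge0 //; lra.
by rewrite ler_pM2l //; lra.
Qed.

(** * Bounding the sum of the b_i by the sup norm *)

Section DerivativeBound.
Context {R : realType} {N : nat}.
Implicit Types (S T : {set 'I_N}) (x y : cube N).

(** The b_i of the overview: the square root of the influence of coordinate [i]. *)
Definition level2 (f : cube N -> R) (i : 'I_N) : R :=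
  Num.sqrt (\sum_(S : {set 'I_N} | i \in S) fcoef f S ^+ 2).

(* The coefficients of [x |-> x_i * (D_i f)(x / 2) / 2]; the factor [x_i] does not
   change absolute values and spares a reindexing of the sets. *)
Definition contracted_part (f : cube N -> R) (i : 'I_N) S : R :=
  if i \in S then fcoef f S / 2 ^+ #|S| else 0.

Lemma coef1_prod_1DZX (y : 'I_N -> R) S :
  (\prod_(i in S) (1 + y i *: 'X))`_1 = \sum_(i in S) y i.
Proof.
suff [] : (\prod_(i in S) (1 + y i *: 'X))`_0 = 1 /\
  (\prod_(i in S) (1 + y i *: 'X))`_1 = \sum_(i in S) y i by [].
elim/big_rec2: _ => [|i s p _ [p0 p1]]; first by rewrite !coef1.
rewrite mulrDl mul1r !coefD -scalerAl !coefZ !coefXM /= p0 p1.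
by rewrite mulr0 addr0 mulr1 addrC.
Qed.

Lemma size_prod_1DZX (y : 'I_N -> R) S :
  leq (size (\prod_(i in S) (1 + y i *: 'X))) #|S|.+1.
Proof.
have size2 i : leq (size (1 + y i *: 'X)) 2.
  apply: leq_trans (size_polyD _ _) _; rewrite size_poly1 geq_max /=.
  by apply: leq_trans (size_scale_leq _ _) _; rewrite size_polyX.
apply: leq_trans (size_poly_prod_leq _ _) _; rewrite leq_subLR addnS ltnS addnn.
rewrite -muln2 -sum_nat_const; exact: leq_sum.
Qed.

(** Let y_i be the sign of the i-th summand. The multilinear extension of [f] at the point x_i (1 +
    t y_i) / 2, which lies in [-1,1]^N for |t| <= 1, is a polynomial in t of degree at most m + 1
    bounded by the sup norm. Its linear coefficient is the sum to be bounded. *)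
Lemma sum_norm_contracted_le m (f : cube N -> R) x : Ble m.+1 f ->
  \sum_i `|walsh_sum (contracted_part f i) x| <= 5 ^+ m * supnorm f.
Proof.
move=> fm; pose h i := walsh_sum (contracted_part f i) x.
pose y i := Num.sg (h i).
have y1 i : `|y i| <= 1 by rewrite /y normr_sg; case: eqP.
pose d S := fcoef f S / 2 ^+ #|S| * walsh R S x.
pose q := \sum_(S : {set 'I_N}) d S *: \prod_(i in S) (1 + y i *: 'X).
have sizeq : (size q <= m.+2)%N.
  apply: leq_trans (size_sum _ _ _) _; apply/bigmax_leqP => S _.
  have [Sm|/fm dS0] := leqP #|S| m.+1.
    apply: leq_trans (size_scale_leq _ _) _.
    by apply: leq_trans (size_prod_1DZX _ _) _.
  by rewrite /d dS0 !mul0r scale0r size_poly0.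
have q1 : q`_1 = \sum_i `|h i|.
  rewrite coef_sum; under eq_bigr do rewrite coefZ coef1_prod_1DZX mulr_sumr.
  rewrite (exchange_big_dep predT) //=; apply: eq_bigr => i _.
  rewrite normrEsg -/(y i) /h /walsh_sum mulr_sumr [LHS]big_mkcond.
  apply: eq_bigr => S _; rewrite /contracted_part /d.
  by case: ifP => _; rewrite ?mul0r ?mulr0 // mulrC.
rewrite -q1; apply: le_trans (ler_norm _) _.
apply: (poly_linear_coef_bound (a := fun k => q`_k)) => t t1.
rewrite -horner_coef_wide //.
have -> : q.[t] = \sum_S fcoef f S *
    \prod_(i in S) (sgnb R (x i) * ((1 + t * y i) / 2)).
  rewrite horner_sum; apply: eq_bigr => S _.
  rewrite hornerZ horner_prod /d -[LHS]mulrA -[LHS]mulrA; congr (fcoef f S * _).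
  rewrite big_split /= -/(walsh R S x) mulrCA; congr (walsh R S x * _).
  rewrite big_split /= prodr_const exprVn mulrC; congr (_ * _).
  by apply: eq_bigr => i _; rewrite !hornerE mulrC.
apply: ler_norm_multilinear => i; rewrite normrM normr_sgnb mul1r.
have : `|t * y i| <= 1 by rewrite normrM mulr_ile1.
rewrite ler_norml => /andP[? ?]; rewrite ger0_norm; lra.
Qed.

(** Here 30 = 6 * 5 and 6^2 = 4 * 9: the 9 is the hypercontractive constant, the 4 undoes the
    factors 2^-|S| after squaring, and the 5 comes from averaging the pointwise bound over x. *)
Lemma sum_level2_le m (f : cube N -> R) : (0 < m)%N -> Ble m f ->
  \sum_i level2 f i <= 30 ^+ m * supnorm f.
Proof.
case: m => // m _ fm; have sup0 := supnorm_ge0 f.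
have level2_le i :
    level2 f i <= 6 ^+ m.+1 * avg (fun x => `|walsh_sum (contracted_part f i) x|).
  set E1 := avg _; have E1_ge0 : 0 <= E1 by exact: avg_ge0.
  rewrite /level2 -(@ler_pXn2r _ 2) ?nnegrE ?sqrtr_ge0 ?(mulr_ge0 _ E1_ge0) ?exprn_ge0 //.
  rewrite sqr_sqrtr; last by apply: sumr_ge0 => S _; exact: sqr_ge0.
  have /walsh_L2_le_L1 : forall S, (m.+1 < #|S|)%N -> contracted_part f i S = 0.
    by move=> S /fm fS; rewrite /contracted_part fS mul0r if_same.
  move=> /(ler_wpM2l (exprn_ge0 m.+1 (ler0n R 4))).
  rewrite mulrA -exprMn (_ : 4 * 9 = 6 ^+ 2); last by ring.
  rewrite exprAC -exprMn => le_d.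
  apply: le_trans le_d.
  rewrite mulr_sumr [leLHS]big_mkcond; apply: ler_sum => S _.
  rewrite /contracted_part; case: ifP => _; last by rewrite expr0n mulr0.
  rewrite expr_div_n exprAC -[2 ^+ 2]natrX mulrCA.
  have [Sm|/fm ->] := leqP #|S| m.+1; last by rewrite expr0n mul0r.
  rewrite ler_peMr ?sqr_ge0 // ler_pdivlMr ?exprn_gt0 // mul1r.
  by rewrite ler_weXn2l // ler1n.
apply: le_trans (ler_sum _ (fun i _ => level2_le i)) _.
rewrite -mulr_sumr -avg_sum.
apply: (@le_trans _ _ (6 ^+ m.+1 * avg (fun x : cube N => 5 ^+ m * supnorm f))).
  rewrite ler_wpM2l ?exprn_ge0 //; apply: ler_avg => x.
  exact: sum_norm_contracted_le.
rewrite avg_cst mulrA ler_wpM2r // (_ : 30 = 6 * 5); last by ring.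
rewrite exprMn.
by rewrite ler_wpM2l ?exprn_ge0 // ler_weXn2l // ler1n.
Qed.

End DerivativeBound.

(** * Bohnenblust-Hille inequality at the critical exponent *)

Section UpperBound.
Context {R : realType} {N : nat}.
Implicit Types (S : {set 'I_N}) (x : cube N) (f : cube N -> R).

Lemma sum_prod_sets (b : 'I_N -> R) :
  \sum_(S : {set 'I_N}) \prod_(i in S) b i = \prod_i (1 + b i).
Proof.
under [RHS]eq_bigr do rewrite addrC.
by rewrite bigA_distr; apply: eq_bigr => S _; rewrite big_mkcond.
Qed.

(* Young's inequality for [u^m = (u^(m+1) w)^(m/(m+1)) (w^(-m))^(1/(m+1))], where
   [w] is the sum of the [1 / b i] over [S]. *)
Lemma exprn_le_weighted m (b : 'I_N -> R) S (u : R) : (0 < #|S| <= m)%N ->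
  (forall i, i \in S -> 0 < b i <= 1) -> 0 <= u ->
  u ^+ m <= \sum_(i in S) u ^+ m.+1 / b i + \prod_(i in S) b i.
Proof.
move=> /andP[S0 Sm] bS u0; rewrite -mulr_sumr; set w := \sum_(i in S) _.
have w_ge i : i \in S -> (b i)^-1 <= w.
  move=> iS; rewrite /w (bigD1 i) //= lerDl; apply: sumr_ge0 => j /andP[jS _].
  by have /andP[/ltW bj _] := bS j jS; rewrite invr_ge0.
have w1 : 1 <= w.
  have /card_gt0P[i iS] := S0; apply: le_trans (w_ge i iS).
  by have /andP[bi0 bi1] := bS i iS; rewrite invf_ge1.
have w0 : 0 < w by apply: lt_le_trans w1.
have wV i : i \in S -> w^-1 <= b i.
  move=> iS; have /andP[bi0 _] := bS i iS.
  by rewrite -[leRHS]invrK lef_pV2 ?posrE ?invr_gt0 ?w_ge.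
(* As w >= 1, the exponent m may be lowered to |S|, leaving one factor w^-1 <= b_i for each i in
   [S]. *)
have w_prod : w^-1 ^+ m <= \prod_(i in S) b i.
  apply: (@le_trans _ _ (w^-1 ^+ #|S|)).
    by rewrite ler_wiXn2l ?invr_ge0 ?(ltW w0) // invf_le1.
  rewrite -prodr_const; apply: ler_prod => i iS.
  by rewrite invr_ge0 (ltW w0) wV.
have prod0 : 0 <= \prod_(i in S) b i.
  by apply: le_trans w_prod; rewrite exprn_ge0 ?invr_ge0 ?ltW.
(* Two cases suffice: either u^m <= w^-m, or u w >= 1 and u^m <= u^(m+1) w. *)
have [uw|wu] := leP u w^-1.
  apply: le_trans (_ : w^-1 ^+ m <= _).
    by rewrite lerXn2r ?nnegrE ?invr_ge0 ?(ltW w0).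
  apply: le_trans w_prod _; rewrite lerDr mulr_ge0 ?exprn_ge0 // ltW //.
rewrite -[leLHS]addr0 lerD // exprSr -mulrA ler_peMr ?exprn_ge0 //.
by rewrite -ler_pdivrMr // mul1r ltW.
Qed.

Lemma level2_sqr f i :
  level2 f i ^+ 2 = \sum_(S : {set 'I_N} | i \in S) fcoef f S ^+ 2.
Proof. by rewrite sqr_sqrtr //; apply: sumr_ge0 => S _; exact: sqr_ge0. Qed.

(** The three parts of the pointwise bound sum to at most 1, 1 and exp 1. The first is the indicator
    of the empty set, which the weighted inequality excludes and where the coefficient is at most
    the sup norm. *)
Lemma bohnenblust_hille_normalized m f : (0 < m)%N -> Ble m f ->
  supnorm f <= 1 -> \sum_i level2 f i <= 1 ->
  \sum_S `|fcoef f S| `^ (2 * m%:R / (m%:R + 1)) <= 2 + expR 1.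
Proof.
move=> m0 fm f1 sum1; set p := 2 * _ / _; pose b := level2 f.
have mR : 0 < m%:R + 1 :> R by rewrite ltr_wpDl.
have p0 : 0 < p by rewrite divr_gt0 ?mulr_gt0 ?ltr0n.
have b_ge0 i : 0 <= b i by exact: sqrtr_ge0.
have b_le1 i : b i <= 1.
  apply: le_trans sum1; rewrite (bigD1 i) //= lerDl.
  by apply: sumr_ge0 => j _; exact: b_ge0.
have pointwise S : `|fcoef f S| `^ p <= (S == set0)%:R +
    (\sum_(i in S) fcoef f S ^+ 2 / b i + \prod_(i in S) b i).
  have rest_ge0 : 0 <= \sum_(i in S) fcoef f S ^+ 2 / b i + \prod_(i in S) b i.
    rewrite addr_ge0 ?prodr_ge0 //.
    by apply: sumr_ge0 => i _; rewrite divr_ge0 ?sqr_ge0.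
  have [->|S0] := eqVneq S set0.
    rewrite -[leLHS]addr0 lerD //=; last by rewrite !big_set0 add0r.
    have -> : 1 = 1 `^ p :> R by rewrite powR1.
    rewrite ge0_ler_powR ?nnegrE ?(ltW p0) //.
    exact: le_trans (ler_norm_fcoef f _) f1.
  have [c0|c0] := eqVneq (fcoef f S) 0.
    by rewrite {1}c0 normr0 powR0 ?gt_eqF // addr_ge0.
  have Sm : (#|S| <= m)%N.
    by rewrite leqNgt; apply: contra c0 => /fm ->.
  (* Chosen so that u^m = |c_S|^p and u^(m+1) = c_S^2. *)
  pose u := `|fcoef f S| `^ (2 / (m%:R + 1)).
  have -> : `|fcoef f S| `^ p = u ^+ m.
    by rewrite -powR_mulrn ?powR_ge0 // -powRrM /p mulrAC.
  have -> : fcoef f S ^+ 2 = u ^+ m.+1.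
    rewrite -[RHS]powR_mulrn ?powR_ge0 // -powRrM -[m.+1%:R]natr1 divfK ?gt_eqF //.
    by rewrite powR_mulrn // real_normK ?num_real.
  rewrite add0r; apply: exprn_le_weighted; rewrite ?powR_ge0 //.
    by rewrite Sm andbT card_gt0.
  move=> i iS; rewrite b_le1 andbT lt_def b_ge0 andbT.
  (* If b_i = 0, every coefficient on a set containing [i] vanishes, in particular c_S. *)
  apply: contra c0 => /eqP bi0.
  have := level2_sqr f i; rewrite -/(b i) bi0 expr0n /= => /esym/eqP.
  rewrite psumr_eq0 => [/allP /(_ S)|T _]; last exact: sqr_ge0.
  by rewrite mem_index_enum iS /= sqrf_eq0 => ->.
apply: le_trans (ler_sum _ (fun S _ => pointwise S)) _.
rewrite !big_split /= -[leRHS]addrA lerD ?lerD //.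
- by rewrite (bigD1 set0) //= eqxx big1 ?addr0 // => S /negPf ->.
- rewrite (exchange_big_dep predT) //=; apply: le_trans sum1.
  apply: ler_sum => i _; rewrite -mulr_suml -level2_sqr -/(b i).
  (* Indices with b_i = 0 contribute nothing, since the inverse of 0 is 0. *)
  have [->|bi0] := eqVneq (b i) 0; first by rewrite invr0 mulr0.
  by rewrite expr2 mulfK.
- rewrite sum_prod_sets.
  apply: (@le_trans _ _ (\prod_i expR (b i))); last by rewrite -expR_sum ler_expR.
  by apply: ler_prod => i _; rewrite addr_ge0 //= expR_ge1Dx.
Qed.

(** * Passage from the critical exponent to smaller p *)

(** For s = m/N <= 1 each counted set has s^m <= s^|S|, so the count times s^m is at most (1 + s)^N
    <= exp m. *)
Lemma card_small_sets m : (0 < m <= N)%N ->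
  #|[set S : {set 'I_N} | (#|S| <= m)%N]|%:R <= (expR 1 * (N%:R / m%:R)) ^+ m :> R.
Proof.
move=> /andP[m0 mN]; pose s : R := m%:R / N%:R.
have N0 : (0 < N)%N by exact: leq_trans mN.
have s0 : 0 < s by rewrite divr_gt0 ?ltr0n.
have s1 : s <= 1 by rewrite ler_pdivrMr ?ltr0n // mul1r ler_nat.
have -> : N%:R / m%:R = s^-1 by rewrite invf_div.
rewrite exprMn exprVn ler_pdivlMr ?exprn_gt0 // -sum1_card natr_sum mulr_suml.
apply: (@le_trans _ _ (\sum_(S : {set 'I_N}) \prod_(i in S) s)).
  rewrite [leLHS]big_mkcond; apply: ler_sum => S _; rewrite inE prodr_const.
  case: ifP => [Sm|_]; last by rewrite exprn_ge0 // ltW.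
  by rewrite mul1r ler_wiXn2l // ltW.
rewrite sum_prod_sets prodr_const card_ord.
apply: (@le_trans _ _ (expR s ^+ N)).
  by rewrite lerXn2r ?nnegrE ?expR_ge0 ?expR_ge1Dx // addr_ge0 // ltW.
by rewrite -!expRM_natl mulr1 mulrC divfK // pnatr_eq0 -lt0n.
Qed.

(** Truncation in place of Hölder: a^p <= t^p when a <= t, and a^p <= a^q t^(p-q) when a > t. The
    threshold t = n^(-1/q) balances n t^p with t^(p-q), at the price of K + 1 for K. *)
Lemma sum_powR_interp (I : finType) (P : pred I) (a : I -> R) (p q n K : R) :
  (forall i, 0 <= a i) -> (forall i, ~~ P i -> a i = 0) ->
  0 < p -> p <= q -> 0 < n -> #|P|%:R <= n -> \sum_i a i `^ q <= K ->
  \sum_i a i `^ p <= (K + 1) * n `^ (1 - p / q).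
Proof.
move=> a0 aP p0 pq n0 Pn sumq; have q0 : 0 < q by exact: lt_le_trans pq.
pose t := n `^ (- q^-1); have t0 : 0 < t by exact: powR_gt0.
have tpq : t `^ (p - q) = n `^ (1 - p / q).
  by rewrite /t -powRrM; congr (_ `^ _); field; rewrite gt_eqF.
have tp : n * t `^ p = n `^ (1 - p / q).
  rewrite -{1}[n](powRr1 (ltW n0)) /t -powRrM -powRD ?(gt_eqF n0) ?implybT //.
  by congr (_ `^ _); field; rewrite gt_eqF.
have pointwise i : a i `^ p <= a i `^ q * t `^ (p - q) + (P i)%:R * t `^ p.
  have [Pi|/aP ->] := boolP (P i); last by rewrite !powR0 ?gt_eqF // !mul0r addr0.
  have [at_|ta] := leP (a i) t.
    rewrite -[leLHS]add0r mul1r lerD ?mulr_ge0 ?powR_ge0 //.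
    by rewrite ge0_ler_powR ?nnegrE ?a0 // ltW.
  have ai0 : 0 < a i by exact: lt_trans ta.
  rewrite -[leLHS]addr0 lerD ?mulr_ge0 ?powR_ge0 //.
  have -> : a i `^ p = a i `^ q * a i `^ (p - q).
    by rewrite -powRD ?(gt_eqF ai0) ?implybT //; congr (_ `^ _); ring.
  rewrite ler_wpM2l ?powR_ge0 // -(opprB q p) !powRN lef_pV2 ?posrE ?powR_gt0 //.
  by rewrite ge0_ler_powR ?nnegrE ?subr_ge0 ?a0 ?(ltW t0) ?(ltW ta).
apply: le_trans (ler_sum _ (fun i _ => pointwise i)) _.
rewrite big_split -!mulr_suml /= tpq mulrDl mul1r lerD //.
  by rewrite ler_wpM2r ?powR_ge0.
rewrite -tp ler_wpM2r ?powR_ge0 // (le_trans _ Pn) // -sum1_card natr_sum.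
by rewrite [leRHS]big_mkcond; apply: ler_sum => i _; rewrite unfold_in; case: (P i).
Qed.

Lemma fcoefZ a f S : fcoef (fun x => a * f x) S = a * fcoef f S.
Proof. by rewrite !fcoefE -avgZ; apply: eq_avg => x; rewrite mulrA. Qed.

Lemma coef_pnormZ a p f : 0 <= a -> p != 0 ->
  coef_pnorm p (fun x => a * f x) = a * coef_pnorm p f.
Proof.
move=> a0 p0; rewrite /coef_pnorm.
under eq_bigr do rewrite fcoefZ normrM (ger0_norm a0) powRM //.
rewrite -mulr_sumr powRM ?powR_ge0 ?sumr_ge0 //.
by rewrite -powRrM divff // powRr1.
Qed.

Lemma coef_pnorm_le_normalized m p f : (0 < m <= N)%N -> Ble m f ->
  supnorm f <= 1 -> \sum_i level2 f i <= 1 ->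
  1 <= p <= 2 * m%:R / (m%:R + 1) ->
  coef_pnorm p f <= (3 + expR 1) * (expR 1 ^+ m *
    (N%:R / m%:R) `^ (m%:R / p - m%:R / 2 - 2^-1)).
Proof.
move=> /andP[m0 mN] fm f1 sum1 /andP[p1]; set q := 2 * _ / _ => pq.
have mR : 0 < m%:R :> R by rewrite ltr0n.
have mR1 : m%:R + 1 != 0 :> R by rewrite gt_eqF // ltr_wpDl ?ltW.
have p0 : 0 < p by exact: lt_le_trans p1.
have q0 : 0 < q by exact: lt_le_trans pq.
have NR : 0 < N%:R :> R by rewrite ltr0n (leq_trans m0).
have eNm : 0 < expR 1 * (N%:R / m%:R) :> R by rewrite mulr_gt0 ?expR_gt0 ?divr_gt0.
have BH := bohnenblust_hille_normalized m0 fm f1 sum1.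
have supp S : ~~ (#|S| <= m)%N -> `|fcoef f S| = 0.
  by rewrite -ltnNge => /fm ->; rewrite normr0.
have card_supp : #|(fun S : {set 'I_N} => #|S| <= m)%N|%:R <=
    (expR 1 * (N%:R / m%:R)) ^+ m :> R.
  rewrite -(eq_card (A := [set S : {set 'I_N} | (#|S| <= m)%N])) ?card_small_sets ?m0 //.
  by move=> S; rewrite inE unfold_in.
have le_sum := sum_powR_interp (fun S => normr_ge0 (fcoef f S)) supp p0 pq
  (exprn_gt0 _ eNm) card_supp BH.
have pV0 : 0 <= p^-1 by rewrite invr_ge0 ltW.
have pV1 : p^-1 <= 1 by rewrite invf_le1.
have K1 : 1 <= 2 + expR 1 + 1 :> R by have := expR_ge0 (1 : R); lra.
have sum_ge0 : 0 <= \sum_S `|fcoef f S| `^ p by apply: sumr_ge0 => S _; exact: powR_ge0.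
apply: le_trans (_ : _ <= ((2 + expR 1 + 1) *
  ((expR 1 * (N%:R / m%:R)) ^+ m) `^ (1 - p / q)) `^ p^-1) _.
  by rewrite ge0_ler_powR ?nnegrE // (le_trans sum_ge0).
rewrite powRM ?powR_ge0 ?(le_trans ler01) // ler_pM ?powR_ge0 //.
  rewrite (_ : 3 + expR 1 = 2 + expR 1 + 1); last by ring.
  by rewrite -[leRHS]powRr1 ?(le_trans ler01) // ler_powR.
rewrite -powR_mulrn ?(ltW eNm) // -!powRrM.
(* The exponent is m (1 - p/q) / p = m/p - m/q, and m/q = (m + 1) / 2. As p >= 1 it is at most m, so
   exp(d) <= exp(1)^m. *)
set d := (X in _ `^ X <= _); have dE : d = m%:R / p - m%:R / 2 - 2^-1.
  by rewrite /d /q; field; rewrite mR1 !gt_eqF.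
have d_m : d <= m%:R.
  have : m%:R / p <= m%:R by rewrite ler_piMr // ltW.
  by rewrite dE; lra.
rewrite powRM ?expR_ge0 ?divr_ge0 // -dE ler_wpM2r ?powR_ge0 //.
rewrite -powR_mulrn ?expR_ge0 // ler_powR // ltW // expR_gt1 //.
Qed.

Lemma coef_pnorm_le m p f : (0 < m <= N)%N -> Ble m f ->
  1 <= p <= 2 * m%:R / (m%:R + 1) ->
  coef_pnorm p f <= (30 * (3 + expR 1) * expR 1) ^+ m *
    (N%:R / m%:R) `^ (m%:R / p - m%:R / 2 - 2^-1) * supnorm f.
Proof.
move=> mN fm pm; have /andP[m0 _] := mN; have /andP[p1 _] := pm.
have pn0 : p != 0 by rewrite gt_eqF // (lt_le_trans _ p1).
have [f0|fn0] := eqVneq (supnorm f) 0.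
  rewrite f0 mulr0 /coef_pnorm big1 ?powR0 ?invr_eq0 // => S _.
  suff -> : fcoef f S = 0 by rewrite normr0 powR0.
  by apply/eqP; rewrite -normr_le0 -f0 ler_norm_fcoef.
have sup0 : 0 < supnorm f by rewrite lt_def fn0 supnorm_ge0.
(* Dividing by [s] achieves both normalizations, the sup norm one because 30^m >= 1. *)
pose s : R := 30 ^+ m * supnorm f.
have s0 : 0 < s by rewrite mulr_gt0 ?exprn_gt0.
pose g x := s^-1 * f x.
have sV0 : 0 <= s^-1 by rewrite invr_ge0 ltW.
have gm : Ble m g by move=> S /fm fS; rewrite fcoefZ fS mulr0.
have pow30 : 1 <= 30 ^+ m :> R by rewrite exprn_ege1 // ler1n.
have g1 : supnorm g <= 1.
  apply: bigmax_le => // x _; rewrite normrM (ger0_norm sV0) mulrC ler_pdivrMr //.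
  by rewrite mul1r (le_trans (ler_supnorm f x)) // ler_peMl // ltW.
have level2g i : level2 g i = s^-1 * level2 f i.
  rewrite /level2; under eq_bigr do rewrite fcoefZ exprMn.
  by rewrite -mulr_sumr sqrtrM ?sqr_ge0 // sqrtr_sqr ger0_norm.
have sum1 : \sum_i level2 g i <= 1.
  under eq_bigr do rewrite level2g.
  by rewrite -mulr_sumr mulrC ler_pdivrMr // mul1r sum_level2_le.
have := coef_pnorm_le_normalized mN gm g1 sum1 pm.
rewrite coef_pnormZ // mulrC ler_pdivrMr // => /le_trans; apply.
set X := _ `^ _; have X0 : 0 <= X by exact: powR_ge0.
have K1 : 1 <= 3 + expR 1 :> R by have := expR_ge0 (1 : R); lra.
rewrite /s !exprMn.
rewrite [leLHS](_ : _ =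
  (3 + expR 1) * (30 ^+ m * expR 1 ^+ m * X * supnorm f)); last by ring.
rewrite [leRHS](_ : _ =
  (3 + expR 1) ^+ m * (30 ^+ m * expR 1 ^+ m * X * supnorm f)); last by ring.
rewrite ler_wpM2r ?ler_eXnr //.
by rewrite !mulr_ge0 ?exprn_ge0 ?expR_ge0 // ltW.
Qed.

End UpperBound.

(** * Random signs and the lower bound *)

Section LowerBound.
Context {R : realType}.

(** For |t| >= 1/2 one has |t| <= 2 t^2. Otherwise exp(s) <= 1 / (1 - s) at s = t and s = -t gives 2
    / (1 - t^2) <= 2 (1 + 2 t^2). *)
Lemma cosh_bound (t : R) : expR t + expR (- t) <= 2 * expR (2 * t ^+ 2).
Proof.
have le_exp (s : R) : expR s <= expR `|s| by rewrite ler_expR ler_norm.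
have [t_large|t_small] := leP 2^-1 `|t|.
  have h : expR `|t| <= expR (2 * t ^+ 2).
    rewrite ler_expR -real_normK ?num_real // expr2 mulrA ler_peMl //.
    by rewrite -ler_pdivrMl // mulr1.
  have := le_exp t; have := le_exp (- t); rewrite normrN; lra.
move: t_small; rewrite ltr_norml => /andP[tl tu].
have expV (s : R) : s < 1 -> expR s <= (1 - s)^-1.
  move=> s1; rewrite -[expR s]invrK -expRN lef_pV2 ?posrE ?expR_gt0 ?subr_gt0 //.
  exact: expR_ge1Dx.
have /expV h1 : t < 1 by lra.
have /expV h2 : - t < 1 by lra.
have t2 : t ^+ 2 <= 4^-1 by nra.
have t2_ge0 : 0 <= t ^+ 2 by exact: sqr_ge0.
have h3 : (1 - t)^-1 + (1 - - t)^-1 <= 2 * (1 + 2 * t ^+ 2).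
  have -> : (1 - t)^-1 + (1 - - t)^-1 = 2 / (1 - t ^+ 2).
    by field; apply/and3P; split; rewrite gt_eqF //; lra.
  by rewrite ler_pdivrMr; [set u := t ^+ 2 in t2 t2_ge0 *; nra|lra].
by have := expR_ge1Dx (2 * t ^+ 2); lra.
Qed.

(** Induction on C(N+1, m+1) = (N+1)/(m+1) C(N, m), using (N+1)/(m+1) <= N/m. *)
Lemma binomial_ge_pow (N m : nat) : (0 < m <= N)%N ->
  (N%:R / m%:R) ^+ m <= 'C(N, m)%:R :> R.
Proof.
elim: m N => // m IHm [|N] //=; rewrite ltnS => mN.
have bin : 'C(N.+1, m.+1)%:R = N.+1%:R / m.+1%:R * 'C(N, m)%:R :> R.
  by rewrite mulrAC -natrM mul_bin_diag natrM mulrAC divff ?mul1r // pnatr_eq0.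
rewrite bin exprS ler_wpM2l ?divr_ge0 //.
have [->|m0] := posnP m; first by rewrite expr0 bin0.
apply: le_trans (IHm N _); last by rewrite m0.
rewrite lerXn2r ?nnegrE ?divr_ge0 // ler_pdivrMr ?ltr0n //.
rewrite mulrAC ler_pdivlMr ?ltr0n // -!natrM ler_nat.
by rewrite mulSn mulnS leq_add2r.
Qed.

Context {N m : nat}.
Implicit Types (eps : {ffun {set 'I_N} -> bool}) (x : cube N).

(** A sign is drawn for every set, so that sums over [eps] factor over all sets; sets of size other
    than [m] contribute a plain factor 2. *)
Definition signs eps (S : {set 'I_N}) : R :=
  if #|S| == m then sgnb R (eps S) else 0.

Lemma sum_expR_signs (x : cube N) (t : R) :
  \sum_eps expR (t * walsh_sum (signs eps) x) <=
  2 ^+ #|{set 'I_N}| * expR (2 * t ^+ 2 * 'C(N, m)%:R).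
Proof.
pose F (S : {set 'I_N}) b : R :=
  if #|S| == m then expR (t * (sgnb R b * walsh R S x)) else 1.
under eq_bigr => eps _.
  rewrite mulr_sumr expR_sum (eq_bigr (fun S => F S (eps S))).
    over.
  by move=> S _; rewrite /F /signs; case: ifP => // _; rewrite mul0r mulr0 exp.expR0.
rewrite -(bigA_distr_bigA F).
pose G (S : {set 'I_N}) : R := 2 * (if #|S| == m then expR (2 * t ^+ 2) else 1).
apply: (@le_trans _ _ (\prod_(S : {set 'I_N}) G S)).
  apply: ler_prod => S _; rewrite big_bool /F /G; case: ifP => _ /=; last first.
    by rewrite mulr1; apply/andP; split; lra.
  rewrite addr_ge0 ?expR_ge0 //=; set w := walsh _ _ _.
  have w2 : (t * w) ^+ 2 = t ^+ 2 by rewrite exprMn [w ^+ 2]walsh_sqr mulr1.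
  by rewrite mulN1r mul1r mulrN -w2 addrC cosh_bound.
rewrite big_split prodr_const /= -big_mkcond /= prodr_const.
have -> : #|(fun S : {set 'I_N} => #|S| == m)| = 'C(N, m).
  have := card_draws 'I_N m; rewrite card_ord => <-.
  by apply: eq_card => S; rewrite inE unfold_in.
by rewrite -expRM_natr.
Qed.

(* Kahane-Salem-Zygmund, by the exponential moment method at [t = sqrt (N/n)],
   where [n] is the number of characters. *)
Lemma exists_small_signs : (0 < m <= N)%N ->
  exists eps, supnorm (walsh_sum (signs eps)) <=
    4 * Num.sqrt (N%:R * 'C(N, m)%:R).
Proof.
move=> /andP[m0 mN]; set n : R := 'C(N, m)%:R.
have n0 : 0 < n by rewrite ltr0n bin_gt0.
have N1 : 1 <= N%:R :> R by rewrite ler1n (leq_trans m0).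
have N0 : 0 < N%:R :> R by lra.
pose t := Num.sqrt (N%:R / n).
have t0 : 0 < t by rewrite sqrtr_gt0 divr_gt0.
have t2 : t ^+ 2 * n = N%:R by rewrite sqr_sqrtr ?divr_ge0 ?ltW // divfK ?gt_eqF.
pose W eps := \sum_x (expR (t * walsh_sum (signs eps) x) +
                      expR (- t * walsh_sum (signs eps) x)).
have W_ge0 eps x : 0 <= expR (t * walsh_sum (signs eps) x) +
    expR (- t * walsh_sum (signs eps) x) by rewrite addr_ge0 ?expR_ge0.
(* [B] bounds the mean of [W]: 2^N points, two exponentials each, and t^2 n = N. Some [eps] is
   therefore at most [B]. *)
pose B : R := 2 ^+ N.+1 * expR (2 * N%:R).
have [eps leB] : exists eps, W eps <= B.
  apply/existsP; rewrite -[X in is_true X]negbK negb_exists; apply/negP => /forallP h.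
  have : \sum_(eps : {ffun {set 'I_N} -> bool}) B < \sum_eps W eps.
    apply: ltr_sum => [|eps _]; last by rewrite ltNge.
    by apply/hasP; exists [ffun=> true]; rewrite ?mem_index_enum.
  apply/negP; rewrite -leNgt /W exchange_big /=.
  rewrite sumr_const card_ffun card_bool.
  apply: (@le_trans _ _ (\sum_(x : cube N)
     2 * (2 ^+ #|{set 'I_N}| * expR (2 * t ^+ 2 * n)))).
    apply: ler_sum => x _; rewrite big_split /= mulr2n mulrDl !mul1r lerD //.
      exact: sum_expR_signs.
    by rewrite -sqrrN; exact: sum_expR_signs.
  rewrite sumr_const card_ffun card_bool card_ord -mulrA t2 /B.
  rewrite -[leLHS]mulr_natl -[leRHS]mulr_natl !natrX exprS.
  move: (_ ^+ #|_|) (expR _) => K E.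
  by rewrite [leRHS](_ : _ = 2 ^+ N * (2 * (K * E))) //; ring.
have exp1 : 2 <= expR 1 :> R by have := expR_ge1Dx (1 : R); lra.
(* By 2 <= exp 1 and (N + 1) + 2N <= 4N. *)
have B_le : B <= expR (4 * N%:R).
  apply: (@le_trans _ _ (expR 1 ^+ N.+1 * expR (2 * N%:R))).
    by rewrite ler_wpM2r ?expR_ge0 // lerXn2r ?nnegrE ?expR_ge0.
  rewrite -expRM_natl -exp.expRD ler_expR mulr1 -natr1; lra.
exists eps; apply: bigmax_le => [|x _]; first by rewrite mulr_ge0 ?sqrtr_ge0.
set y := walsh_sum _ x.
have leW : expR (t * y) + expR (- t * y) <= expR (4 * N%:R).
  apply: le_trans (le_trans leB B_le); rewrite /W (bigD1 x) //= lerDl.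
  by apply: sumr_ge0.
have ty : t * `|y| <= 4 * N%:R.
  have e1 := expR_ge0 (t * y); have e2 := expR_ge0 (- t * y).
  rewrite -ler_expR; case: (ler0P y) => _; last by lra.
  by rewrite mulrN -mulNr; lra.
rewrite -(ler_pM2l t0); apply: le_trans ty _.
rewrite mulrCA /t -sqrtrM ?divr_ge0 ?(ltW n0) // (_ : _ / _ * _ = N%:R ^+ 2).
  by rewrite sqrtr_sqr ger0_norm.
by field; rewrite gt_eqF.
Qed.

Lemma coef_pnorm_signs eps p : 0 < p ->
  coef_pnorm p (walsh_sum (signs eps)) = 'C(N, m)%:R `^ p^-1.
Proof.
move=> p0; congr (_ `^ _).
have -> : 'C(N, m) = #|[set S : {set 'I_N} | #|S| == m]|.
  by rewrite card_draws card_ord.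
rewrite -sum1_card natr_sum [RHS]big_mkcond /=; apply: eq_bigr => S _.
rewrite fcoef_walsh_sum inE /signs; case: ifP => _.
  by rewrite normr_sgnb powR1.
by rewrite normr0 powR0 ?gt_eqF.
Qed.

Lemma supnorm_signs_ge1 eps : (m <= N)%N -> 1 <= supnorm (walsh_sum (signs eps)).
Proof.
move=> mN; have : (0 < #|[set S : {set 'I_N} | #|S| == m]|)%N.
  by rewrite card_draws card_ord bin_gt0.
move=> /card_gt0P[S]; rewrite inE => Sm.
apply: le_trans (ler_norm_fcoef _ S).
by rewrite fcoef_walsh_sum /signs Sm normr_sgnb.
Qed.

(** The ratio is at least n^(1/p - 1/2) / (4 sqrt N). As p <= 2, the bound n >= (N/m)^m may be
    raised to the power 1/p - 1/2. Writing N = (N/m) m moves sqrt(N/m) into the exponent and leaves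
    4 sqrt m <= 8^m. *)
Lemma exists_large_ratio (p : R) : (0 < m <= N)%N -> 1 <= p <= 2 ->
  exists f : cube N -> R, [/\ Beq m f, supnorm f != 0 &
    (8 ^+ m)^-1 * (N%:R / m%:R) `^ (m%:R / p - m%:R / 2 - 2^-1) <=
    coef_pnorm p f / supnorm f].
Proof.
move=> mN /andP[p1 p2]; have /andP[m0 le_mN] := mN.
have p0 : 0 < p by exact: lt_le_trans p1.
have [eps small] := exists_small_signs mN.
have ge1 := supnorm_signs_ge1 eps le_mN.
exists (walsh_sum (signs eps)); split.
- by move=> S /negPf Sm; rewrite fcoef_walsh_sum /signs Sm.
- by rewrite gt_eqF // (lt_le_trans _ ge1).
rewrite ler_pdivlMr ?(lt_le_trans _ ge1) // coef_pnorm_signs //.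
set n : R := 'C(N, m)%:R in small *; set e := _ - _ - _.
have n0 : 0 < n by rewrite ltr0n bin_gt0.
have N0 : 0 < N%:R :> R by rewrite ltr0n (leq_trans m0).
have mR : 0 < m%:R :> R by rewrite ltr0n.
have x0 : 0 < N%:R / m%:R :> R by rewrite divr_gt0.
have a0 : 0 <= p^-1 - 2^-1 by rewrite subr_ge0 lef_pV2 ?posrE.
have X_le : (N%:R / m%:R) `^ e * Num.sqrt N%:R <= n `^ (p^-1 - 2^-1) * Num.sqrt m%:R.
  have -> : (N%:R : R) = N%:R / m%:R * m%:R by rewrite divfK ?gt_eqF.
  rewrite mulfK ?gt_eqF // sqrtrM ?(ltW x0) // mulrA ler_wpM2r ?sqrtr_ge0 //.
  rewrite -powR12_sqrt ?(ltW x0) // -powRD ?(gt_eqF x0) ?implybT //.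
  rewrite (_ : e + 2^-1 = m%:R * (p^-1 - 2^-1)); last by rewrite /e; ring.
  rewrite powRrM powR_mulrn ?(ltW x0) //.
  rewrite ge0_ler_powR ?nnegrE ?(ltW n0) ?exprn_ge0 ?(ltW x0) //.
  exact: binomial_ge_pow.
have sqrt_n : n `^ (p^-1 - 2^-1) * Num.sqrt n = n `^ p^-1.
  rewrite -powR12_sqrt ?(ltW n0) // -powRD ?(gt_eqF n0) ?implybT //.
  by congr (_ `^ _); ring.
have m8 : 4 * Num.sqrt m%:R <= 8 ^+ m :> R.
  have m1 : 1 <= m%:R :> R by rewrite ler1n.
  have sqrt_le : Num.sqrt m%:R <= m%:R :> R.
    have s1 : 1 <= Num.sqrt m%:R :> R by rewrite -{1}(sqrtr1 R) ler_wsqrtr.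
    by have := sqr_sqrtr (ltW mR); nra.
  have two : m%:R <= 2 ^+ m :> R by rewrite -natrX ler_nat ltnW // ltn_expl.
  have four : 4 <= 4 ^+ m :> R by rewrite -{1}[4]expr1 ler_weXn2l // ler1n.
  have -> : 8 = 4 * 2 :> R by ring.
  by rewrite exprMn ler_pM ?sqrtr_ge0 // (le_trans sqrt_le).
rewrite -mulrA ler_pdivrMl ?exprn_gt0 //.
apply: le_trans (ler_wpM2l (powR_ge0 _ _) small) _.
rewrite sqrtrM ?(ltW N0) // -sqrt_n.
apply: (@le_trans _ _ (4 * (n `^ (p^-1 - 2^-1) * Num.sqrt m%:R) * Num.sqrt n)).
  rewrite [leLHS](_ : _ =
    4 * ((N%:R / m%:R) `^ e * Num.sqrt N%:R) * Num.sqrt n); last by ring.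
  by rewrite ler_wpM2r ?sqrtr_ge0 // ler_wpM2l.
rewrite [leLHS](_ : _ =
  4 * Num.sqrt m%:R * (n `^ (p^-1 - 2^-1) * Num.sqrt n)); last by ring.
by rewrite ler_wpM2r // mulr_ge0 ?powR_ge0 ?sqrtr_ge0.
Qed.

End LowerBound.

(** * Both estimates combined into bounds on the Sidon constants *)

Theorem theorem6p8 :
  exists gamma : Rdefinitions.R, 1 <= gamma /\
  forall (N m : nat), (1 <= m)%N -> (m <= N)%N ->
  forall p r : Rdefinitions.R,
    1 <= p -> p <= 2 * m%:R / (m%:R + 1) -> r^-1 = p^-1 - 2^-1 ->
    let e := m%:R / r - 2^-1 in
    (gamma ^+ m)^-1 * powR (N%:R / m%:R) e <= sidon p (@Beq _ N m) /\
    sidon p (@Beq _ N m) <= sidon p (@Ble _ N m) /\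
    sidon p (@Ble _ N m) <= gamma ^+ m * powR (N%:R / m%:R) e.
Proof.
(* The constant of the upper bound; it exceeds the 8 of the lower bound. *)
pose gamma : Rdefinitions.R := 30 * (3 + expR 1) * expR 1.
have exp1 : 1 <= expR (1 : Rdefinitions.R).
  by have := expR_ge1Dx (1 : Rdefinitions.R); lra.
have gamma8 : 8 <= gamma by rewrite /gamma; nra.
exists gamma; split; first by lra.
move=> N m m0 mN p r p1 pq rE e; have m0N : (0 < m <= N)%N by rewrite m0.
have mR : 0 < m%:R :> Rdefinitions.R by rewrite ltr0n.
have -> : e = m%:R / p - m%:R / 2 - 2^-1 by rewrite /e rE; ring.
have p2 : p <= 2.
  by apply: le_trans pq _; rewrite ler_pdivrMr; lra.
have Beq_le (f : cube N -> Rdefinitions.R) : Beq m f -> Ble m f.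
  by move=> fm S mS; apply: fm; rewrite gtn_eqF.
set X := powR _ _; have X0 : 0 <= X by exact: powR_ge0.
have Ble_bound : ubound [set c | exists f, @Ble _ N m f /\ supnorm f != 0 /\
    c = coef_pnorm p f / supnorm f]%classic (gamma ^+ m * X).
  move=> _ [f [fm [f0 ->]]].
  rewrite ler_pdivrMr ?lt_def ?f0 ?supnorm_ge0 //.
  by apply: coef_pnorm_le => //; rewrite p1.
have [f [fm f0 f_large]] := exists_large_ratio m0N (introT andP (conj p1 p2)).
(* [sup] is a least upper bound only for nonempty sets bounded above: the witness [f] gives
   nonemptiness, the upper estimate boundedness. *)
have Beq_bound : has_ubound [set c | exists f, @Beq _ N m f /\ supnorm f != 0 /\
    c = coef_pnorm p f / supnorm f]%classic.
  exists (gamma ^+ m * X) => c [g [gm gc]]; apply: Ble_bound.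
  by exists g; split => //; exact: Beq_le.
split; last split.
- apply: (@le_trans _ _ ((8 ^+ m)^-1 * X)); last first.
    apply: le_trans f_large _; apply: ub_le_sup Beq_bound _ _.
    by exists f.
  rewrite ler_wpM2r // lef_pV2 ?posrE ?exprn_gt0 //; last by lra.
  by rewrite lerXn2r ?nnegrE //; lra.
- apply: ge_sup => [|c [g [gm gc]]]; first by exists (coef_pnorm p f / supnorm f), f.
  apply: ub_le_sup; first by exists (gamma ^+ m * X).
  by exists g; split => //; exact: Beq_le.
- apply: ge_sup Ble_bound.
  by exists (coef_pnorm p f / supnorm f), f; split => //; exact: Beq_le.
Qed.
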